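(* Let $e_0,e_t,e_1,e_\infty\in\mathbb C^*$ and $a_l=e_l+e_l^{-1}$ for $l\in\{0,t,1,\infty\}$. For every permutation $(i,j,k)$ of $(0,t,1)$ the Fricke polynomial decomposes as \begin{align*} F(X,\theta)=&\,(X_k-\tfrac{e_i}{e_j}-\tfrac{e_j}{e_i})(F_{X_k}-X_k+\tfrac{e_i}{e_j}+\tfrac{e_j}{e_i})\\&+\tfrac1{e_ie_j}(e_iX_i+e_jX_j-a_\infty-e_ie_ja_k)(e_iX_j+e_jX_i-a_k-e_ie_ja_\infty)\\ =&\,(X_k-e_ie_j-\tfrac1{e_ie_j})(F_{X_k}-X_k+e_ie_j+\tfrac1{e_ie_j})\\&+\tfrac1{e_ie_j}(e_ie_jX_i+X_j-e_ja_\infty-e_ia_k)(e_ie_jX_j+X_i-e_ja_k-e_ia_\infty)\\ =&\,(X_k-\tfrac{e_k}{e_\infty}-\tfrac{e_\infty}{e_k})(F_{X_k}-X_k+\tfrac{e_k}{e_\infty}+\tfrac{e_\infty}{e_k})\\&+\tfrac1{e_ke_\infty}(e_\infty X_i+e_kX_j-a_i-e_ke_\infty a_j)(e_kX_i+e_\infty X_j-a_j-e_ke_\infty a_i)\\ =&\,(X_k-e_ke_\infty-\tfrac1{e_ke_\infty})(F_{X_k}-X_k+e_ke_\infty+\tfrac1{e_ke_\infty})\\&+\tfrac1{e_ke_\infty}(X_j+e_ke_\infty X_i-e_ka_i-e_\infty a_j)(X_i+e_ke_\infty X_j-e_ka_j-e_\infty a_i). \end{align*} In particular the following 24 lines (counted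 with multiplicity) are contained in $\mathcal S_{VI}(\theta)$: \begin{align*} &\{X_k=\tfrac{e_i}{e_j}+\tfrac{e_j}{e_i},\ e_iX_i+e_jX_j=a_\infty+e_ie_ja_k\},&&\{X_k=\tfrac{e_i}{e_j}+\tfrac{e_j}{e_i},\ e_iX_j+e_jX_i=a_k+e_ie_ja_\infty\},\\ &\{X_k=e_ie_j+\tfrac1{e_ie_j},\ X_i+e_ie_jX_j=e_ja_k+e_ia_\infty\},&&\{X_k=e_ie_j+\tfrac1{e_ie_j},\ X_j+e_ie_jX_i=e_ja_\infty+e_ia_k\},\\ &\{X_k=\tfrac{e_k}{e_\infty}+\tfrac{e_\infty}{e_k},\ e_\infty X_i+e_kX_j=a_i+e_ke_\infty a_j\},&&\{X_k=\tfrac{e_k}{e_\infty}+\tfrac{e_\infty}{e_k},\ e_kX_i+e_\infty X_j=a_j+e_ke_\infty a_i\},\\ &\{X_k=e_ke_\infty+\tfrac1{e_ke_\infty},\ X_i+e_ke_\infty X_j=e_ka_j+e_\infty a_i\},&&\{X_k=e_ke_\infty+\tfrac1{e_ke_\infty},\ X_j+e_ke_\infty X_i=e_ka_i+e_\infty a_j\}. \end{align*} For each pair $l,m\in\{0,t,1,\infty\}$, each of the two planes $$X_n=e_le_m+\tfrac1{e_le_m},\qquad X_n=\tfrac{e_l}{e_m}+\tfrac{e_m}{e_l},\qquad\text{with }(l,m,n)=(i,j,k)\ \text{or}\ (k,\infty,k),$$ intersects $\mathcal S_{VI}(\theta)$ in 2 lines. The resulting 4 lines correspond to the reducibility of the pair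 of matrices $\{M_l,M_m\}$, i.e. to the existence of a common invariant (one-dimensional) subspace for the pair.
   Context: For coordinates $X=(X_0,X_t,X_1)\in\mathbb C^3$, $F(X,\theta)=X_0X_tX_1+X_0^2+X_t^2+X_1^2-\theta_0X_0-\theta_tX_t-\theta_1X_1+\theta_\infty$, with $\theta_i=a_ia_\infty+a_ja_k$ for $\{i,j,k\}=\{0,t,1\}$ and $\theta_\infty=a_0a_ta_1a_\infty+a_0^2+a_t^2+a_1^2+a_\infty^2-4$; $F_{X_i}=\partial F/\partial X_i=X_jX_k+2X_i-\theta_i$. The character variety of $P_{VI}$ is $\mathcal S_{VI}(\theta)=\{X\in\mathbb C^3:F(X,\theta)=0\}$. It parametrizes quadruples $M_0,M_t,M_1,M_\infty\in SL_2(\mathbb C)$ with $M_\infty M_1M_tM_0=I$ and $\mathrm{tr}\,M_l=a_l$ (so $M_l$ has eigenvalues $e_l^{\pm1}$) up to simultaneous conjugation, through the trace coordinates $X_0=\mathrm{tr}(M_1M_t)$, $X_t=\mathrm{tr}(M_0M_1)$, $X_1=\mathrm{tr}(M_tM_0)$. In the paper $e_l=e^{\pi i\vartheta_l}$ for $\vartheta\in\mathbb C^4$.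
   Formalization: For the pair {M_t, M_∞} the reducibility claim is false as written (M_t and M_∞ are not adjacent in M_∞M_1M_tM_0=I); it is proved with M_1^{-1}M_∞M_1 in place of M_∞. The other five pairs are as stated. *)

(* Defs.v *)
From HB Require Import structures.
From mathcomp Require Import all_boot all_order all_algebra.
From mathcomp Require Import mpoly.
From mathcomp Require Import boolp classical_sets reals complex.

Set Implicit Arguments.
Unset Strict Implicit.
Unset Printing Implicit Defensive.

Import GRing.Theory.
Local Open Scope ring_scope.
Local Open Scope classical_set_scope.

(* The finite singular points 0, t, 1; data attached to infinity are passed   *)
(* separately (arguments ending in "inf").                                    *)
Definition s0 : 'I_3 := @Ordinal 3 0 isT.
Definition st : 'I_3 := @Ordinal 3 1 isT.
Definition s1 : 'I_3 := @Ordinal 3 2 isT.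

Section Fricke.
Variable K : fieldType.
Implicit Types (a e : 'I_3 -> K) (ainf einf : K).

Definition theta a ainf (i : 'I_3) : K :=
  a i * ainf + \prod_(j | j != i) a j.

Definition theta_inf a ainf : K :=
  a s0 * a st * a s1 * ainf
  + a s0 ^+ 2 + a st ^+ 2 + a s1 ^+ 2 + ainf ^+ 2 - 4.

Definition fricke (th : 'I_3 -> K) (thinf : K) : {mpoly K[3]} :=
  'X_s0 * 'X_st * 'X_s1 + 'X_s0 ^+ 2 + 'X_st ^+ 2 + 'X_s1 ^+ 2
  - th s0 *: 'X_s0 - th st *: 'X_st - th s1 *: 'X_s1 + thinf%:MP.

Definition S_VI (th : 'I_3 -> K) (thinf : K) : set 'rV[K]_3 :=
  [set X | (fricke th thinf).@[X 0] = 0].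

Definition quot_val (x y : K) : K := x / y + y / x.
Definition prod_val (x y : K) : K := x * y + (x * y)^-1.

Definition plane (k : 'I_3) (v : K) : set 'rV[K]_3 := [set X | X 0 k = v].

Definition is_line (L : set 'rV[K]_3) : Prop :=
  exists p d : 'rV[K]_3, d != 0 /\ L = [set X | exists s : K, X = p + s *: d].

(* The two lines, counted with multiplicity (they may coincide), in each of   *)
(* the planes X_k = e_i/e_j + e_j/e_i and X_k = e_i e_j + 1/(e_i e_j).        *)
Definition quot_lines e einf (i j k : 'I_3) : set 'rV[K]_3 * set 'rV[K]_3 :=
  let a l := e l + (e l)^-1 in
  let ainf := einf + einf^-1 in
  ([set X : 'rV[K]_3 | X 0 k = quot_val (e i) (e j) /\
      e i * X 0 i + e j * X 0 j = ainf + e i * e j * a k],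
   [set X : 'rV[K]_3 | X 0 k = quot_val (e i) (e j) /\
      e i * X 0 j + e j * X 0 i = a k + e i * e j * ainf]).

Definition prod_lines e einf (i j k : 'I_3) : set 'rV[K]_3 * set 'rV[K]_3 :=
  let a l := e l + (e l)^-1 in
  let ainf := einf + einf^-1 in
  ([set X : 'rV[K]_3 | X 0 k = prod_val (e i) (e j) /\
      X 0 i + e i * e j * X 0 j = e j * a k + e i * ainf],
   [set X : 'rV[K]_3 | X 0 k = prod_val (e i) (e j) /\
      X 0 j + e i * e j * X 0 i = e j * ainf + e i * a k]).

(* Same for X_k = e_k/e_inf + e_inf/e_k and X_k = e_k e_inf + 1/(e_k e_inf).  *)
Definition quot_lines_inf e einf (i j k : 'I_3) :
    set 'rV[K]_3 * set 'rV[K]_3 :=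
  let a l := e l + (e l)^-1 in
  ([set X : 'rV[K]_3 | X 0 k = quot_val (e k) einf /\
      einf * X 0 i + e k * X 0 j = a i + e k * einf * a j],
   [set X : 'rV[K]_3 | X 0 k = quot_val (e k) einf /\
      e k * X 0 i + einf * X 0 j = a j + e k * einf * a i]).

Definition prod_lines_inf e einf (i j k : 'I_3) :
    set 'rV[K]_3 * set 'rV[K]_3 :=
  let a l := e l + (e l)^-1 in
  ([set X : 'rV[K]_3 | X 0 k = prod_val (e k) einf /\
      X 0 i + e k * einf * X 0 j = e k * a j + einf * a i],
   [set X : 'rV[K]_3 | X 0 k = prod_val (e k) einf /\
      X 0 j + e k * einf * X 0 i = e k * a i + einf * a j]).

Definition lines8 e einf (i j k : 'I_3) : seq (set 'rV[K]_3) :=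
  [:: (quot_lines e einf i j k).1; (quot_lines e einf i j k).2;
      (prod_lines e einf i j k).1; (prod_lines e einf i j k).2;
      (quot_lines_inf e einf i j k).1; (quot_lines_inf e einf i j k).2;
      (prod_lines_inf e einf i j k).1; (prod_lines_inf e einf i j k).2].

(* Exchanging i and j only permutes lines8, so one ordering for each k lists  *)
(* every line with its multiplicity.                                          *)
Definition lines24 e einf : seq (set 'rV[K]_3) :=
  lines8 e einf s0 st s1 ++ lines8 e einf st s1 s0 ++ lines8 e einf s1 s0 st.

(* The four lines attached to a pair of singular points. *)
Definition lines4 e einf (i j k : 'I_3) : set 'rV[K]_3 :=
  (quot_lines e einf i j k).1 `|` (quot_lines e einf i j k).2 `|`
  ((prod_lines e einf i j k).1 `|` (prod_lines e einf i j k).2).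

Definition lines4_inf e einf (i j k : 'I_3) : set 'rV[K]_3 :=
  (quot_lines_inf e einf i j k).1 `|` (quot_lines_inf e einf i j k).2 `|`
  ((prod_lines_inf e einf i j k).1 `|` (prod_lines_inf e einf i j k).2).

Definition quadruple a ainf (M : 'I_3 -> 'M[K]_2) (Minf : 'M[K]_2) : Prop :=
  [/\ forall i, \det (M i) = 1 /\ \tr (M i) = a i,
      \det Minf = 1, \tr Minf = ainf
    & Minf *m M s1 *m M st *m M s0 = 1%:M].

Definition trace_coords (M : 'I_3 -> 'M[K]_2) : 'rV[K]_3 :=
  \row_k \tr (if k == s0 then M s1 *m M st
              else if k == st then M s0 *m M s1
              else M st *m M s0).

Definition reducible_pair (A B : 'M[K]_2) : Prop :=
  exists v : 'cV[K]_2,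
    [/\ v != 0, exists l, A *m v = l *: v & exists m, B *m v = m *: v].

(* The monodromy at infinity to be paired with M_k, where {i, j, k} =         *)
(* {0, t, 1}: the product of the two must have the trace of (M_i M_j)^-1,     *)
(* since X_k = tr (M_i M_j).  For k = 0, 1 this is M_inf itself, as           *)
(* M_0 M_inf = (M_1 M_t)^-1 and M_inf M_1 = (M_t M_0)^-1.  In the cyclic      *)
(* order of the relation M_inf M_1 M_t M_0 = I, M_t and M_inf are not         *)
(* neighbours: tr (M_t M_inf) is not X_t but the other root of F in X_t, so   *)
(* the loop around infinity has to be moved across the one around 1, giving   *)
(* N = M_1^-1 M_inf M_1 with N M_t = (M_0 M_1)^-1.                            *)
Definition Minf_for (M : 'I_3 -> 'M[K]_2) (Minf : 'M[K]_2) (k : 'I_3) :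
    'M[K]_2 :=
  if k == st then invmx (M s1) *m Minf *m M s1 else Minf.

End Fricke.

(* Main.v *)
Require Import Defs.
From HB Require Import structures.
From mathcomp Require Import all_boot all_order all_algebra.
From mathcomp Require Import mpoly ring.
From mathcomp Require Import boolp classical_sets reals complex.

Set Implicit Arguments.
Unset Strict Implicit.
Unset Printing Implicit Defensive.

Import GRing.Theory.
Local Open Scope ring_scope.
Local Open Scope complex_scope.
Local Open Scope classical_set_scope.

(* Write a_i = u + 1/u and a_j = v + 1/v. The Fricke polynomial splits off the
   factor X_k - uv - 1/(uv), with a remainder that is a product of two affine
   forms; replacing v by 1/v gives the planes X_k = u/v + v/u, and exchanging
   (a_i, a_j) with (a_k, a_inf), which leaves F unchanged, gives the planes
   attached to the pair {k, infinity}. On the matrix side, A and B have a common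
   eigenvector iff tr [A, B] = 2, a quadratic equation for tr AB whose roots are
   precisely uv + 1/(uv) and u/v + v/u. Conversely, each line is the locus on
   which an explicit pair of triangular matrices with prescribed eigenvalues
   completes to a quadruple. *)

(** * Permutations of the three finite singular points *)

Lemma ord3_ind (P : 'I_3 -> Prop) : P s0 -> P st -> P s1 -> forall i, P i.
Proof.
move=> P0 Pt P1 [[|[|[|//]]] hi].
- by rewrite (_ : Ordinal hi = s0) //; apply: val_inj.
- by rewrite (_ : Ordinal hi = st) //; apply: val_inj.
- by rewrite (_ : Ordinal hi = s1) //; apply: val_inj.
Qed.

(* The base cases are the rotations of (1, t, 0), the cyclic order in which the
   finite matrices occur in M_inf M_1 M_t M_0 = 1. *)
Lemma uniq3_ind (P : 'I_3 -> 'I_3 -> 'I_3 -> Prop) :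
    (forall i j k, P i j k -> P j i k) ->
    P s1 st s0 -> P st s0 s1 -> P s0 s1 st ->
  forall i j k, uniq [:: i; j; k] -> P i j k.
Proof.
move=> Psym P0 P1 Pt i j k.
by elim/ord3_ind: i; elim/ord3_ind: j; elim/ord3_ind: k => // _; apply: Psym.
Qed.

Lemma uniq3_cover (i j k l : 'I_3) :
  uniq [:: i; j; k] -> [|| l == i, l == j | l == k].
Proof.
move=> ijk; elim/uniq3_ind: i j k / ijk => [i j k|||]; first by rewrite orbCA.
all: by elim/ord3_ind: l.
Qed.

Lemma uniq3_neq (T : eqType) (i j k : T) :
  uniq [:: i; j; k] -> [/\ i != j, i != k & j != k].
Proof. by rewrite /= !inE negb_or !andbT => /andP[/andP[? ?] ?]. Qed.

(** * The Fricke form and its decompositions *)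

(* (x, y, z) stands for (X_i, X_j, X_k) and (a, b, c, d) for
   (a_i, a_j, a_k, a_inf), as polynomials or as their values. *)
Definition fricke_form (T : comNzRingType) (x y z a b c d : T) : T :=
  x * y * z + x ^+ 2 + y ^+ 2 + z ^+ 2
  - (a * d + b * c) * x - (b * d + a * c) * y - (c * d + a * b) * z
  + (a * b * c * d + a ^+ 2 + b ^+ 2 + c ^+ 2 + d ^+ 2 - 4).

Lemma fricke_form_sym (T : comNzRingType) (x y z a b c d : T) :
  fricke_form y x z b a c d = fricke_form x y z a b c d.
Proof. rewrite /fricke_form; ring. Qed.

(** Exchanging (a, b) with (c, d) only swaps the two products that make up each linear
    coefficient. *)
Lemma fricke_form_pair (T : comNzRingType) (x y z a b c d : T) :
  fricke_form x y z c d a b = fricke_form x y z a b c d.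
Proof. rewrite /fricke_form; ring. Qed.

(** The inverses are separate elements [u'] and [v'], so that one identity serves both in the
    polynomial ring, where [u] and [v] are constants, and for values in a field. *)
Lemma fricke_form_prod (T : comNzRingType) (x y z u u' v v' c d : T) :
    u * u' = 1 -> v * v' = 1 ->
  fricke_form x y z (u + u') (v + v') c d =
    (z - u * v - u' * v')
    * (x * y + 2 * z - (c * d + (u + u') * (v + v')) - z + u * v + u' * v')
  + u' * v' * ((u * v * x + y - v * d - u * c)
              * (u * v * y + x - v * c - u * d)).
Proof. rewrite /fricke_form => hu hv; ring: hu hv. Qed.

(** This is [fricke_form_prod] with [v] and [v'] exchanged: each affine factor is multiplied by [v],
    and in compensation [u' * v] becomes [u' * v']. *)
Lemma fricke_form_quot (T : comNzRingType) (x y z u u' v v' c d : T) :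
    u * u' = 1 -> v * v' = 1 ->
  fricke_form x y z (u + u') (v + v') c d =
    (z - u * v' - v * u')
    * (x * y + 2 * z - (c * d + (u + u') * (v + v')) - z + u * v' + v * u')
  + u' * v' * ((u * x + v * y - d - u * v * c)
              * (u * y + v * x - c - u * v * d)).
Proof. rewrite /fricke_form => hu hv; ring: hu hv. Qed.

(** * From the form to the polynomial F, its values and its derivatives *)

Lemma thetaE (K : fieldType) (a : 'I_3 -> K) (ainf : K) i j k :
  uniq [:: i; j; k] -> theta a ainf i = a i * ainf + a j * a k.
Proof.
move=> ijk; have [ij ik jk] := uniq3_neq ijk.
rewrite /theta (bigD1 j) 1?eq_sym // (bigD1 k) /=; last first.
  by rewrite ![k == _]eq_sym ik.
rewrite big_pred0 ?mulr1 // => l.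
by have /or3P[] := uniq3_cover l ijk => ->; rewrite ?andbF.
Qed.

Lemma fricke_poly_form (K : fieldType) (a : 'I_3 -> K) (ainf : K) i j k :
    uniq [:: i; j; k] ->
  fricke (theta a ainf) (theta_inf a ainf) =
  fricke_form 'X_i 'X_j 'X_k
    (a i)%:MP_[3] (a j)%:MP_[3] (a k)%:MP_[3] ainf%:MP_[3].
Proof.
move=> ijk; elim/uniq3_ind: i j k / ijk => [i j k ->|||].
  by rewrite fricke_form_sym.
all: rewrite /fricke (@thetaE _ _ _ s0 st s1) // (@thetaE _ _ _ st s0 s1) //.
all: rewrite (@thetaE _ _ _ s1 s0 st) // -!mul_mpolyC /theta_inf /fricke_form.
all: ring.
Qed.

Lemma fricke_eval (K : fieldType) (a : 'I_3 -> K) (ainf : K) (X : 'rV[K]_3)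
    i j k : uniq [:: i; j; k] ->
  (fricke (theta a ainf) (theta_inf a ainf)).@[X 0] =
  fricke_form (X 0 i) (X 0 j) (X 0 k) (a i) (a j) (a k) ainf.
Proof.
move=> /fricke_poly_form->; rewrite /fricke_form.
have -> : 4 = 4%:MP_[3] :> {mpoly K[3]} by rewrite rmorph_nat.
by rewrite !(mevalD, mevalN, mevalM, expr2, mevalC, mevalXU).
Qed.

Lemma fricke_deriv (K : fieldType) (a : 'I_3 -> K) (ainf : K) i j k :
    uniq [:: i; j; k] ->
  (fricke (theta a ainf) (theta_inf a ainf))^`M(k) =
  'X_i * 'X_j + 2 * 'X_k - (a k * ainf + a i * a j)%:MP_[3].
Proof.
move=> ijk; rewrite (fricke_poly_form _ _ ijk) /fricke_form.
have [ij ik jk] := uniq3_neq ijk.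
have dX (l : 'I_3) : ('X_l : {mpoly K[3]})^`M(k) = (l == k)%:R.
  rewrite mderivX mnm1E eq_sym; case: eqP => [<-|_]; last by rewrite scale0r.
  by rewrite scale1r -{1}(add0m U_(k)%MM) addmK mpolyX0.
have -> : 4 = 4%:MP_[3] :> {mpoly K[3]} by rewrite rmorph_nat.
rewrite !(mderivD, mderivN, mderivM, mderivC, expr2, dX) eqxx.
rewrite (negPf ik) (negPf jk) /=; ring.
Qed.

(** On this plane the first product of [fricke_form_prod] vanishes, and the scalar in front of the
    second one is a unit. *)
Lemma fricke_form_prod_val (K : fieldType) (x y u v c d : K) :
    u != 0 -> v != 0 ->
  (fricke_form x y (prod_val u v) (u + u^-1) (v + v^-1) c d == 0) =
  (x + u * v * y == v * c + u * d) || (y + u * v * x == v * d + u * c).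
Proof.
move=> u0 v0; rewrite (fricke_form_prod _ _ _ _ _ (mulfV u0) (mulfV v0)).
rewrite /prod_val -!(subr_eq0 (_ + _ * _ * _)) orbC -mulf_eq0.
have uv0 : u^-1 * v^-1 != 0 by rewrite mulf_neq0 ?invr_eq0.
rewrite -[RHS](mulrI_eq0 _ (mulfI uv0)); congr (_ == 0).
by rewrite invfM; ring.
Qed.

Lemma fricke_form_quot_val (K : fieldType) (x y u v c d : K) :
    u != 0 -> v != 0 ->
  (fricke_form x y (quot_val u v) (u + u^-1) (v + v^-1) c d == 0) =
  (u * x + v * y == d + u * v * c) || (u * y + v * x == c + u * v * d).
Proof.
move=> u0 v0; rewrite (fricke_form_quot _ _ _ _ _ (mulfV u0) (mulfV v0)).
rewrite /quot_val -!(subr_eq0 (_ + _ * _)) -mulf_eq0.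
have uv0 : u^-1 * v^-1 != 0 by rewrite mulf_neq0 ?invr_eq0.
by rewrite -[RHS](mulrI_eq0 _ (mulfI uv0)); congr (_ == 0); ring.
Qed.

(** * Lines cut out by two affine equations *)

Lemma is_line_eqs (K : fieldType) (i j k : 'I_3) (p q r v : K) :
    uniq [:: i; j; k] -> q != 0 ->
  is_line [set X | X 0 k = v /\ p * X 0 i + q * X 0 j = r].
Proof.
move=> ijk q0; have [ij ik jk] := uniq3_neq ijk.
(* Since [q] is nonzero, [X_j] is a function of [X_i]: the base point has i-th coordinate 0, the
   direction is [(q, - p)] in the coordinates i, j, and the parameter of [X] is [X 0 i / q]. *)
exists (\row_l (if l == k then v else if l == j then r / q else 0)).
exists (\row_l (if l == i then q else if l == j then - p else 0)); split.
  by apply/eqP => /rowP/(_ i); rewrite !mxE eqxx; apply/eqP.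
apply/seteqP; split=> X /=.
  move=> [Xk Xij]; exists (X 0 i / q); apply/rowP => l; rewrite !mxE.
  have [->|lk] := eqVneq l k.
    by rewrite !(eq_sym k) (negPf ik) (negPf jk) Xk; ring.
  have [->|li] := eqVneq l i; first by rewrite (negPf ij); field.
  have [->|lj] := eqVneq l j; first by rewrite -Xij; field.
  by have := uniq3_cover l ijk; rewrite (negPf lk) (negPf li) (negPf lj).
move=> [s ->]; rewrite !mxE !(eq_sym k) !(eq_sym j i) !eqxx.
rewrite (negPf ij) (negPf ik) (negPf jk); split; first by ring.
by field.
Qed.

Lemma is_line_eqs1 (K : fieldType) (i j k : 'I_3) (q r v : K) :
    uniq [:: i; j; k] -> q != 0 ->
  is_line [set X | X 0 k = v /\ X 0 i + q * X 0 j = r].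
Proof.
move=> ijk q0; have := is_line_eqs 1 r v ijk q0.
by congr is_line; apply/funext => X /=; rewrite mul1r.
Qed.

Lemma perm_eq_swap2 (T : eqType) (x y : T) (s t : seq T) :
  perm_eq s t -> perm_eq [:: y, x & s] [:: x, y & t].
Proof. by move=> st; rewrite (perm_catCA [:: y] [:: x] s) /= !perm_cons. Qed.

(** * Plane sections of the surface and the 24 lines *)

Section PlaneSections.
Variables (K : fieldType) (e : 'I_3 -> K) (einf : K).
Hypotheses (he : forall l, e l != 0) (heinf : einf != 0).
Let a l := e l + (e l)^-1.
Let ainf := einf + einf^-1.
Let S := S_VI (theta a ainf) (theta_inf a ainf).

(** Here each line is itself symmetric in i and j; in the three other families the exchange swaps
    the two lines. *)
Lemma quot_lines_sym i j k :
  quot_lines e einf j i k = quot_lines e einf i j k.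
Proof.
rewrite /quot_lines /quot_val; congr pair; apply/seteqP; split=> X /= [-> h].
all: split; first by ring.
all: by rewrite addrC h; ring.
Qed.

Lemma prod_lines_sym i j k :
  prod_lines e einf j i k =
  ((prod_lines e einf i j k).2, (prod_lines e einf i j k).1).
Proof.
rewrite /prod_lines /prod_val (mulrC (e j)).
congr pair; apply/seteqP; split=> X /= [-> h].
all: by split; first ring; rewrite h addrC.
Qed.

Lemma quot_lines_inf_sym i j k :
  quot_lines_inf e einf j i k =
  ((quot_lines_inf e einf i j k).2, (quot_lines_inf e einf i j k).1).
Proof.
rewrite /quot_lines_inf; congr pair; apply/seteqP; split=> X /= [-> <-].
all: by split; last rewrite addrC.
Qed.

Lemma prod_lines_inf_sym i j k :
  prod_lines_inf e einf j i k =
  ((prod_lines_inf e einf i j k).2, (prod_lines_inf e einf i j k).1).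
Proof. by []. Qed.

Lemma lines8_sym i j k :
  perm_eq (lines8 e einf j i k) (lines8 e einf i j k).
Proof.
rewrite /lines8 quot_lines_sym prod_lines_sym quot_lines_inf_sym.
rewrite prod_lines_inf_sym /= !perm_cons.
by do 3!apply: perm_eq_swap2.
Qed.

Lemma plane_quot i j k : uniq [:: i; j; k] ->
  plane k (quot_val (e i) (e j)) `&` S =
  (quot_lines e einf i j k).1 `|` (quot_lines e einf i j k).2.
Proof.
move=> ijk; have E := fricke_form_quot_val _ _ _ _ (he i) (he j).
apply/seteqP; split=> X /=; rewrite /S /S_VI /= (fricke_eval _ _ _ ijk).
  by move=> [Xk] /eqP; rewrite Xk E => /orP[] /eqP ?; [left|right].
by move=> [] [Xk /eqP h]; split=> //; apply/eqP; rewrite Xk E h ?orbT.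
Qed.

Lemma plane_prod i j k : uniq [:: i; j; k] ->
  plane k (prod_val (e i) (e j)) `&` S =
  (prod_lines e einf i j k).1 `|` (prod_lines e einf i j k).2.
Proof.
move=> ijk; have E := fricke_form_prod_val _ _ _ _ (he i) (he j).
apply/seteqP; split=> X /=; rewrite /S /S_VI /= (fricke_eval _ _ _ ijk).
  by move=> [Xk] /eqP; rewrite Xk E => /orP[] /eqP ?; [left|right].
by move=> [] [Xk /eqP h]; split=> //; apply/eqP; rewrite Xk E h ?orbT.
Qed.

Lemma plane_quot_inf i j k : uniq [:: i; j; k] ->
  plane k (quot_val (e k) einf) `&` S =
  (quot_lines_inf e einf i j k).1 `|` (quot_lines_inf e einf i j k).2.
Proof.
move=> ijk; have E := fricke_form_quot_val _ _ _ _ (he k) heinf.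
apply/seteqP; split=> X /=; rewrite /S /S_VI /= (fricke_eval _ _ _ ijk).
  (* With (a_i, a_j) and (a_k, a_inf) exchanged, the two factors come out in the opposite order to
     [quot_lines_inf]. *)
  rewrite -fricke_form_pair.
  move=> [Xk] /eqP; rewrite Xk E => /orP[] /eqP ?; [right|left]; split=> //.
  by rewrite addrC.
rewrite -fricke_form_pair => -[] [Xk /eqP h]; split=> //; apply/eqP.
  by rewrite Xk E (addrC (e k * X 0 j)) h orbT.
by rewrite Xk E h.
Qed.

Lemma plane_prod_inf i j k : uniq [:: i; j; k] ->
  plane k (prod_val (e k) einf) `&` S =
  (prod_lines_inf e einf i j k).1 `|` (prod_lines_inf e einf i j k).2.
Proof.
move=> ijk; have E := fricke_form_prod_val _ _ _ _ (he k) heinf.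
apply/seteqP; split=> X /=; rewrite /S /S_VI /= (fricke_eval _ _ _ ijk).
  rewrite -fricke_form_pair.
  move=> [Xk] /eqP; rewrite Xk E => /orP[] /eqP h; [left|right].
  - by rewrite /= h addrC.
  - by rewrite /= h addrC.
rewrite -fricke_form_pair => -[] [Xk /eqP h]; split=> //; apply/eqP.
  by rewrite Xk E [X in _ == X]addrC h.
by rewrite Xk E [X in _ || (_ == X)]addrC h orbT.
Qed.

Lemma lines8_spec i j k L : uniq [:: i; j; k] ->
  L \in lines8 e einf i j k -> is_line L /\ L `<=` S.
Proof.
move=> ijk.
have sub v L1 L2 : plane k v `&` S = L1 `|` L2 -> L1 `<=` S /\ L2 `<=` S.
  move=> E; split=> X LX; suff : (plane k v `&` S) X by case.
  - by rewrite E; left.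
  - by rewrite E; right.
(* Some of the second lines have an equation led by [X_j], which calls for the exchanged order. *)
have jik : uniq [:: j; i; k].
  by rewrite (perm_uniq (perm_eq_swap2 _ _ (perm_refl [:: k]))).
have ukinf : e k * einf != 0 by rewrite mulf_neq0.
have uij : e i * e j != 0 by rewrite mulf_neq0.
have [? ?] := sub _ _ _ (plane_quot ijk).
have [? ?] := sub _ _ _ (plane_prod ijk).
have [? ?] := sub _ _ _ (plane_quot_inf ijk).
have [? ?] := sub _ _ _ (plane_prod_inf ijk).
rewrite !inE => /or4P[|||/or4P[||| /orP[]]] /eqP->; split=> //.
- exact: is_line_eqs.
- exact: is_line_eqs.
- exact: is_line_eqs1.
- exact: is_line_eqs1.
- exact: is_line_eqs.
- exact: is_line_eqs.
- exact: is_line_eqs1.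
- exact: is_line_eqs1.
Qed.

(** Up to permutation [lines8] depends only on its last index, so both sides add up the same three
    counts. *)
Lemma lines24_perm i j k : uniq [:: i; j; k] ->
  perm_eq (lines24 e einf)
    (lines8 e einf i j k ++ lines8 e einf j k i ++ lines8 e einf k i j).
Proof.
have csym p i' j' k' : count p (lines8 e einf i' j' k') =
                       count p (lines8 e einf j' i' k').
  by apply/permP; rewrite perm_sym lines8_sym.
move=> ijk; apply/permP => p; rewrite /lines24 !count_cat.
elim/uniq3_ind: i j k / ijk => [i j k ->|||].
- by rewrite (csym p i j k) (csym p j k i) (csym p k i j)
     [X in (_ + X)%N]addnC.
- by rewrite (csym p s0 st) (csym p st s1) (csym p s1 s0) addnCA.
- by rewrite (csym p s0 st) (csym p st s1) (csym p s1 s0) [X in (_ + X)%N]addnC.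
- by rewrite (csym p s0 st) (csym p st s1) (csym p s1 s0) addnC addnAC addnC.
Qed.

Lemma lines24_spec L : L \in lines24 e einf -> is_line L /\ L `<=` S.
Proof.
by rewrite !mem_cat => /or3P[]; apply: lines8_spec.
Qed.

(** On the surface the plane sections reduce membership in the four lines to the value of [X_k]
    alone, which is what reducibility prescribes. *)
Lemma lines4P i j k X : uniq [:: i; j; k] -> S X ->
  lines4 e einf i j k X <->
  X 0 k = quot_val (e i) (e j) \/ X 0 k = prod_val (e i) (e j).
Proof.
move=> ijk SX; rewrite /lines4 -plane_quot // -plane_prod //.
by split=> [[[? _]|[? _]]|[?|?]]; [left|right|left|right].
Qed.

Lemma lines4_infP i j k X : uniq [:: i; j; k] -> S X ->
  lines4_inf e einf i j k X <->
  X 0 k = quot_val (e k) einf \/ X 0 k = prod_val (e k) einf.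
Proof.
move=> ijk SX; rewrite /lines4_inf -plane_quot_inf // -plane_prod_inf //.
by split=> [[[? _]|[? _]]|[?|?]]; [left|right|left|right].
Qed.

(** Replacing e_i or e_j by its inverse carries the four lines into one another, so all take the
    form of the second line of [prod_lines]. Only this normal form then has to be realized by
    matrices. *)
Lemma lines4_eigenvalues i j k X : lines4 e einf i j k X ->
  exists l m, [/\ l != 0, m != 0, l + l^-1 = a i, m + m^-1 = a j &
    X 0 k = prod_val l m /\ l * m * X 0 i + X 0 j = m * ainf + l * a k].
Proof.
have nz := invr_eq0; rewrite /prod_val /a /ainf.
move=> [[[Xk h]|[Xk h]]|[[Xk h]|[Xk h]]].
- exists (e i), (e j)^-1; split; rewrite ?invrK ?nz //; first by rewrite addrC.
  split; first by rewrite Xk /quot_val; field; rewrite ?he ?heinf ?oner_neq0.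
  apply: (mulfI (he j)); transitivity (e i * X 0 i + e j * X 0 j).
    by field; rewrite ?he ?heinf ?oner_neq0.
  by rewrite h; field; rewrite ?he ?heinf ?oner_neq0.
- exists (e i)^-1, (e j); split; rewrite ?invrK ?nz //; first by rewrite addrC.
  split; first by rewrite Xk /quot_val; field; rewrite ?he ?heinf ?oner_neq0.
  apply: (mulfI (he i)); transitivity (e i * X 0 j + e j * X 0 i).
    by field; rewrite ?he ?heinf ?oner_neq0.
  by rewrite h; field; rewrite ?he ?heinf ?oner_neq0.
- exists (e i)^-1, (e j)^-1; split; rewrite ?invrK ?nz //; try by rewrite addrC.
  split; first by rewrite Xk /prod_val; field; rewrite ?he ?heinf ?oner_neq0.
  have ij0 : e i * e j != 0 by rewrite mulf_neq0.
  apply: (mulfI ij0); transitivity (X 0 i + e i * e j * X 0 j).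
    by field; rewrite ?he ?heinf ?oner_neq0.
  by rewrite h; field; rewrite ?he ?heinf ?oner_neq0.
- exists (e i), (e j); split=> //; split=> //.
  by rewrite -h addrC.
Qed.

(** The same normalization with e_k and e_inf, towards the second line of [prod_lines_inf]. *)
Lemma lines4_inf_eigenvalues i j k X : lines4_inf e einf i j k X ->
  exists l m, [/\ l != 0, m != 0, l + l^-1 = a k, m + m^-1 = ainf &
    X 0 k = prod_val l m /\ l * m * X 0 i + X 0 j = l * a i + m * a j].
Proof.
have nz := invr_eq0; rewrite /prod_val /a /ainf.
move=> [[[Xk h]|[Xk h]]|[[Xk h]|[Xk h]]].
- exists (e k)^-1, einf; split; rewrite ?invrK ?nz //; first by rewrite addrC.
  split; first by rewrite Xk /quot_val; field; rewrite ?he ?heinf ?oner_neq0.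
  apply: (mulfI (he k)); transitivity (einf * X 0 i + e k * X 0 j).
    by field; rewrite ?he ?heinf ?oner_neq0.
  by rewrite h; field; rewrite ?he ?heinf ?oner_neq0.
- exists (e k), einf^-1; split; rewrite ?invrK ?nz //; first by rewrite addrC.
  split; first by rewrite Xk /quot_val; field; rewrite ?he ?heinf ?oner_neq0.
  apply: (mulfI heinf); transitivity (e k * X 0 i + einf * X 0 j).
    by field; rewrite ?he ?heinf ?oner_neq0.
  by rewrite h; field; rewrite ?he ?heinf ?oner_neq0.
- exists (e k)^-1, einf^-1; split; rewrite ?invrK ?nz //; try by rewrite addrC.
  split; first by rewrite Xk /prod_val; field; rewrite ?he ?heinf ?oner_neq0.
  have kinf0 : e k * einf != 0 by rewrite mulf_neq0.
  apply: (mulfI kinf0); transitivity (X 0 i + e k * einf * X 0 j).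
    by field; rewrite ?he ?heinf ?oner_neq0.
  by rewrite h; field; rewrite ?he ?heinf ?oner_neq0.
- exists (e k), einf; split=> //; split=> //.
  by rewrite -h addrC.
Qed.

End PlaneSections.

(** * Traces, determinants and common eigenvectors of two-by-two matrices *)

Section TwoByTwo.
Variable K : fieldType.
Implicit Types (A B C : 'M[K]_2) (u v : 'cV[K]_2).

Lemma mulmx2E m n (A : 'M[K]_(m, 2)) (B : 'M[K]_(2, n)) i j :
  (A *m B) i j = A i 0 * B 0 j + A i 1 * B 1 j.
Proof.
rewrite mxE !big_ord_recl big_ord0 addr0.
by congr (_ * _ + A _ _ * B _ _); apply: val_inj.
Qed.

Lemma mxtrace2E A : \tr A = A 0 0 + A 1 1.
Proof.
rewrite /mxtrace !big_ord_recl big_ord0 addr0.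
by congr (_ + A _ _); apply: val_inj.
Qed.

Lemma det2E A : \det A = A 0 0 * A 1 1 - A 0 1 * A 1 0.
Proof.
rewrite (expand_det_row _ 0) !big_ord_recl big_ord0 addr0 /cofactor !det_mx11.
rewrite !mxE /= expr0 expr1 mul1r mulN1r mulrN.
by congr (_ * A _ _ - A _ _ * A _ _); apply: val_inj.
Qed.

Lemma ord2_ind (P : 'I_2 -> Prop) : P 0 -> P 1 -> forall i, P i.
Proof.
move=> P0 P1 [[|[|//]] hi].
- by rewrite (_ : Ordinal hi = 0) //; apply: val_inj.
- by rewrite (_ : Ordinal hi = 1) //; apply: val_inj.
Qed.

Lemma det2_1 A : \det A = 1 -> A 0 0 * A 1 1 = 1 + A 0 1 * A 1 0.
Proof. by rewrite det2E => /eqP; rewrite subr_eq => /eqP. Qed.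

(** The inverse is the adjugate [A'], which exchanges the diagonal entries; [1 - i] is the other
    index. *)
Lemma mxtrace_inv2 A B : \det A = 1 -> A *m B = 1%:M -> \tr B = \tr A.
Proof.
move=> dA AB; pose A' : 'M[K]_2 := \matrix_(i, j)
  (if i == j then A (1 - i) (1 - i) else - A i j).
have AA' : A *m A' = 1%:M.
  apply/matrixP; elim/ord2_ind; elim/ord2_ind; rewrite mulmx2E !mxE /=
    ?subrr ?subr0; ring: (det2_1 dA).
have uA : A \in unitmx by rewrite unitmxE dA unitr1.
have -> : B = A' by apply: (can_inj (mulKmx uA)); rewrite AA'.
by rewrite !mxtrace2E !mxE /= subrr subr0 addrC.
Qed.

(** Complementary blocks of a cyclic product equal to 1 are inverse to each other, hence have equal
    traces. *)
Lemma mxtrace_cycle4 A B C D :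
    \det A = 1 -> \det B = 1 -> \det C = 1 -> A *m B *m C *m D = 1%:M ->
  [/\ \tr (B *m C *m D) = \tr A, \tr (C *m D) = \tr (A *m B),
      \tr (D *m A) = \tr (B *m C) & \tr D = \tr (A *m B *m C)].
Proof.
move=> dA dB dC ABCD.
have BCDA : B *m C *m (D *m A) = 1%:M.
  by rewrite mulmxA; apply: mulmx1C; rewrite !mulmxA.
split; apply: mxtrace_inv2; rewrite ?det_mulmx ?dA ?dB ?dC ?mulr1 //.
all: by rewrite !mulmxA.
Qed.

(** [D] is the inverse of [A *m B *m C]; the traces come from [mxtrace_cycle4] for this cycle and
    its rotation by one step. *)
Lemma complete_cycle4 A B C : \det A = 1 -> \det B = 1 -> \det C = 1 ->
  exists D, [/\ \det D = 1, \tr D = \tr (A *m B *m C),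
    \tr (C *m D *m A) = \tr B, \tr (C *m D) = \tr (A *m B) &
    \tr (D *m A) = \tr (B *m C)].
Proof.
move=> dA dB dC.
have dABC : \det (A *m B *m C) = 1 by rewrite !det_mulmx dA dB dC !mulr1.
have dD : \det (invmx (A *m B *m C)) = 1 by rewrite det_inv dABC invr1.
have ABCD : A *m B *m C *m invmx (A *m B *m C) = 1%:M.
  by rewrite mulmxV // unitmxE dABC unitr1.
have [_ tCD tDA tD] := mxtrace_cycle4 dA dB dC ABCD.
move: (invmx _) dD ABCD tCD tDA tD => D dD ABCD tCD tDA tD.
have BCDA : B *m C *m D *m A = 1%:M by apply: mulmx1C; rewrite !mulmxA.
by have [tCDA _ _ _] := mxtrace_cycle4 dB dC dD BCDA; exists D.
Qed.

(** The Fricke relation: a polynomial identity in the twelve entries modulo the three determinant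
    equations. *)
Lemma fricke_trace A B C : \det A = 1 -> \det B = 1 -> \det C = 1 ->
  fricke_form (\tr (B *m C)) (\tr (C *m A)) (\tr (A *m B))
    (\tr A) (\tr B) (\tr C) (\tr (A *m B *m C)) = 0.
Proof.
move=> /det2_1 dA /det2_1 dB /det2_1 dC.
rewrite /fricke_form !mxtrace2E !mulmx2E.
ring: dA dB dC.
Qed.

(** As AB - BA = ([A, B] - 1) BA, both sides are 2 - tr [A, B], the right one by Fricke's commutator
    formula. *)
Lemma det_commutator A B : \det A = 1 -> \det B = 1 ->
  \det (A *m B - B *m A) =
  4 + \tr A * \tr B * \tr (A *m B)
  - \tr A ^+ 2 - \tr B ^+ 2 - \tr (A *m B) ^+ 2.
Proof.
move=> /det2_1 dA /det2_1 dB.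
have subE (M N : 'M[K]_2) i j : (M - N) i j = M i j - N i j by rewrite !mxE.
rewrite det2E !mxtrace2E !subE !mulmx2E.
ring: dA dB.
Qed.

Lemma det0_colP A :
  reflect (exists2 v : 'cV[K]_2, v != 0 & A *m v = 0) (\det A == 0).
Proof.
rewrite -det_tr; apply: (iffP det0P) => -[v v0 Av0].
- by exists v^T; rewrite ?trmx_eq0 // -[A]trmxK -trmx_mul Av0 trmx0.
- by exists v^T; rewrite ?trmx_eq0 // -trmx_mul Av0 trmx0.
Qed.

Lemma det_sub_scalar2 A (m : K) :
  \det (A - m%:M) = \det A - m * \tr A + m ^+ 2.
Proof. by rewrite !det2E mxtrace2E !mxE /= mulr1n mulr0n; ring. Qed.

Lemma eigenvector2 A (l : K) : l != 0 -> \det A = 1 -> \tr A = l + l^-1 ->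
  exists2 v : 'cV[K]_2, v != 0 & A *m v = l *: v.
Proof.
move=> l0 dA tA; have : \det (A - l%:M) == 0.
  by rewrite det_sub_scalar2 dA tA mulrDr mulfV //; apply/eqP; ring.
move=> /det0_colP[v v0 /eqP Av]; exists v => //; apply/eqP.
by move: Av; rewrite mulmxBl mul_scalar_mx subr_eq0.
Qed.

Lemma eigenvalue2 A v (l m : K) :
  l != 0 -> \det A = 1 -> \tr A = l + l^-1 -> v != 0 -> A *m v = m *: v ->
  m = l \/ m = l^-1.
Proof.
move=> l0 dA tA v0 Av.
have : \det (A - m%:M) == 0.
  by apply/det0_colP; exists v; rewrite // mulmxBl mul_scalar_mx Av subrr.
have -> : \det (A - m%:M) = (m - l) * (m - l^-1).
  by rewrite det_sub_scalar2 dA tA; field.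
rewrite mulf_eq0 !subr_eq0.
by move=> /orP[] /eqP; [left|right].
Qed.

(** The determinant of the matrix with columns [u] and [v], used to detect collinearity. *)
Definition wedge u v : K := u 0 0 * v 1 0 - u 1 0 * v 0 0.

Lemma wedge0_collinear u v : u != 0 -> wedge u v = 0 -> exists c, v = c *: u.
Proof.
move=> u0 /eqP; rewrite subr_eq0 => /eqP uv.
have /orP[h|h] : (u 0 0 != 0) || (u 1 0 != 0).
  apply: contra_neqT u0; rewrite negb_or !negbK => /andP[/eqP h0 /eqP h1].
  by apply/colP; elim/ord2_ind; rewrite mxE.
- exists (v 0 0 / u 0 0); apply/colP; elim/ord2_ind; rewrite mxE.
    by rewrite mulfVK.
  by apply: (mulfI h); rewrite uv; field.
- exists (v 1 0 / u 1 0); apply/colP; elim/ord2_ind; rewrite mxE.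
    by apply: (mulfI h); rewrite -uv; field.
  by rewrite mulfVK.
Qed.

(** Cramer's rule. *)
Lemma wedge_span u v x : wedge u v != 0 -> exists p q, x = p *: u + q *: v.
Proof.
move=> uv; exists (wedge x v / wedge u v), (wedge u x / wedge u v).
move: uv; rewrite /wedge => uv.
by apply/colP; elim/ord2_ind; rewrite !mxE; field.
Qed.

(* det (AB - BA) = 2 - tr [A, B] vanishes exactly for these values of tr AB.
   A kernel vector v of AB - BA yields a common eigenvector: either v is an
   eigenvector of A, and then Bv lies in the same eigenspace, or B is a
   polynomial in A because v and Av form a basis. *)
Lemma reducible_pairP A B (l m : K) : l != 0 -> m != 0 ->
    \det A = 1 -> \det B = 1 -> \tr A = l + l^-1 -> \tr B = m + m^-1 ->
  reducible_pair A B <->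
  \tr (A *m B) = quot_val l m \/ \tr (A *m B) = prod_val l m.
Proof.
move=> l0 m0 dA dB tA tB; split.
  move=> [v [v0 [l' Av] [m' Bv]]].
  have l'E := eigenvalue2 l0 dA tA v0 Av.
  have m'E := eigenvalue2 m0 dB tB v0 Bv.
  have lm' : l' * m' != 0.
    by case: l'E m'E => -> [] ->; rewrite mulf_neq0 ?invr_eq0.
  have dAB : \det (A *m B) = 1 by rewrite det_mulmx dA dB mulr1.
  have ABv : A *m B *m v = (l' * m') *: v.
    by rewrite -mulmxA Bv -scalemxAr Av scalerA mulrC.
  (* The trace is read off from the characteristic equation of AB at the eigenvalue l'm', the
     determinant being 1. *)
  have tAB : \tr (A *m B) = l' * m' + (l' * m')^-1.
    have : \det (A *m B - (l' * m')%:M) == 0.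
      by apply/det0_colP; exists v; rewrite // mulmxBl mul_scalar_mx ABv subrr.
    rewrite det_sub_scalar2 dAB => /eqP h; apply: (mulfI lm').
    rewrite mulrDr mulfV //; apply/eqP; rewrite -subr_eq0 -oppr_eq0.
    by apply/eqP; rewrite -[RHS]h; ring.
  rewrite tAB /quot_val /prod_val.
  by case: l'E m'E => -> [] ->; [right|left|left|right]; field;
    rewrite ?l0 ?m0 ?oner_neq0.
move=> tAB; have : \det (A *m B - B *m A) == 0.
  rewrite det_commutator // tA tB; apply/eqP.
  by case: tAB => ->; rewrite /quot_val /prod_val; field; rewrite l0 m0.
move=> /det0_colP[v v0 /eqP]; rewrite mulmxBl subr_eq0 -!mulmxA => /eqP ABv.
have [Av|Av] := eqVneq (wedge v (A *m v)) 0.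
  have [c Avc] := wedge0_collinear v0 Av.
  have [Bv|Bv] := eqVneq (wedge v (B *m v)) 0.
    by exists v; split=> //; [exists c | apply: wedge0_collinear].
  (* Both v and Bv are eigenvectors of A for c and they span the plane, so A is the scalar c and any
     eigenvector of B will do. *)
  have [u u0 Bu] := eigenvector2 m0 dB tB.
  exists u; split=> //; last by exists m.
  exists c; have [p [q ->]] := wedge_span u Bv.
  rewrite mulmxDr -!scalemxAr ABv Avc -scalemxAr.
  by rewrite scalerDr !scalerA !(mulrC c).
have [u u0 Au] := eigenvector2 l0 dA tA.
have [p [q uE]] := wedge_span u Av.
(* From Bv = r v + s Av and the commutation on v, B agrees with r + sA on v, and the eigenvalue of B
   at u is r + s l. *)
have [r [s BvE]] := wedge_span (B *m v) Av.
exists u; split=> //; first by exists l.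
exists (r + s * l).
rewrite {1}uE mulmxDr -!scalemxAr -ABv BvE mulmxDr -!scalemxAr.
rewrite scalerDl -[(s * l) *: u]scalerA -Au uE mulmxDr -!scalemxAr.
by rewrite !scalerDr !scalerA addrACA ![_ * r]mulrC ![_ * s]mulrC.
Qed.

(* With C = [[0, -1], [1, c]] and A, B upper triangular, tr CA and tr BC are
   prescribed by the off-diagonal entries, and tr ABC is then forced. *)
Lemma realize_triple (l m c d x y : K) : l != 0 -> m != 0 ->
    l * m * x + y = m * d + l * c ->
  exists A B C : 'M[K]_2,
    [/\ \det A = 1, \det B = 1 & \det C = 1] /\
    [/\ \tr A = l + l^-1, \tr B = m + m^-1, \tr C = c
      & \tr (A *m B *m C) = d] /\
    [/\ \tr (B *m C) = x, \tr (C *m A) = y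
      & \tr (A *m B) = l * m + (l * m)^-1].
Proof.
move=> l0 m0 h; pose mx a b c d : 'M[K]_2 := \matrix_(i, j)
  (if i == 0 then if j == 0 then a else b else if j == 0 then c else d).
exists (mx l (y - c / l) 0 l^-1), (mx m (x - c / m) 0 m^-1), (mx 0 (-1) 1 c).
have -> : d = (l * m * x + y - l * c) / m by rewrite h; field.
rewrite !det2E !mxtrace2E !mulmx2E !mxE /=.
by do !split; field; rewrite ?l0 ?m0.
Qed.

End TwoByTwo.

(** * Monodromy quadruples and their trace coordinates *)

Section Quadruples.
Variables (K : fieldType) (a : 'I_3 -> K) (ainf : K).
Let S := S_VI (theta a ainf) (theta_inf a ainf).

Lemma trace_coordsE (M : 'I_3 -> 'M[K]_2) i j k :
  uniq [:: i; j; k] -> trace_coords M 0 k = \tr (M i *m M j).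
Proof.
move=> ijk; rewrite mxE.
by elim/uniq3_ind: i j k / ijk => //= i j k ->; rewrite mxtrace_mulC.
Qed.

(** This is [fricke_trace] for (M_1, M_t, M_0), since the relation gives tr (M_1 M_t M_0) = tr
    M_inf. *)
Lemma quadruple_S_VI M Minf : quadruple a ainf M Minf -> S (trace_coords M).
Proof.
move=> [dM dinf tinf MMMM].
rewrite /S /S_VI /= (@fricke_eval _ _ _ _ s1 st s0) //.
rewrite (@trace_coordsE M st s0 s1) // (@trace_coordsE M s0 s1 st) //.
rewrite (@trace_coordsE M s1 st s0) //.
have [d0 t0] := dM s0; have [dt tt] := dM st; have [d1 t1] := dM s1.
have := fricke_trace d1 dt d0.
have MMMM' : M s1 *m M st *m M s0 *m Minf = 1%:M.
  by apply: mulmx1C; rewrite !mulmxA.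
have [_ _ _ <-] := mxtrace_cycle4 d1 dt d0 MMMM'.
by rewrite tinf t0 tt t1.
Qed.

Lemma Minf_for_spec M Minf k : quadruple a ainf M Minf ->
  [/\ \det (Minf_for M Minf k) = 1, \tr (Minf_for M Minf k) = ainf &
      \tr (M k *m Minf_for M Minf k) = trace_coords M 0 k].
Proof.
move=> [dM dinf tinf MMMM].
have [d0 t0] := dM s0; have [dt tt] := dM st; have [d1 t1] := dM s1.
have u1 : M s1 \in unitmx by rewrite unitmxE d1 unitr1.
have [_ x0 x1 _] := mxtrace_cycle4 dinf d1 dt MMMM.
elim/ord3_ind: k; rewrite /Minf_for /= mxE /=.
- by split=> //.
- split.
  + by rewrite !det_mulmx det_inv d1 dinf invr1 !mulr1.
  + by rewrite mxtrace_mulC mulmxA mulmxV // mul1mx.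
  (* Conjugating M_inf M_1 M_t M_0 = 1 by M_1 shows that N M_t is the inverse of M_0 M_1. *)
  apply/esym; rewrite [RHS]mxtrace_mulC; apply: mxtrace_inv2.
    by rewrite !det_mulmx det_inv d1 dinf dt invr1 !mulr1.
  by rewrite !mulmxA -!(mulmxA (invmx _)) MMMM mul1mx mulVmx.
- by split=> //; rewrite mxtrace_mulC.
Qed.

(** M_inf has to be the inverse of M_1 M_t M_0, and in SL_2 it has the same trace. *)
Lemma realize_quadruple (M0 Mt M1 : 'M[K]_2) (X : 'rV[K]_3) :
    [/\ \det M0 = 1, \det Mt = 1 & \det M1 = 1] ->
    [/\ \tr M0 = a s0, \tr Mt = a st, \tr M1 = a s1
      & \tr (M1 *m Mt *m M0) = ainf] ->
    [/\ \tr (M1 *m Mt) = X 0 s0, \tr (M0 *m M1) = X 0 st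
      & \tr (Mt *m M0) = X 0 s1] ->
  exists (M : 'I_3 -> 'M[K]_2) (Minf : 'M[K]_2),
    quadruple a ainf M Minf /\ trace_coords M = X.
Proof.
move=> [d0 dt d1] [t0 tt t1 tinf] [x0 xt x1].
pose M (l : 'I_3) := if l == s0 then M0 else if l == st then Mt else M1.
have dMMM : \det (M1 *m Mt *m M0) = 1 by rewrite !det_mulmx d0 dt d1 !mulr1.
have uMMM : M1 *m Mt *m M0 \in unitmx by rewrite unitmxE dMMM unitr1.
exists M, (invmx (M1 *m Mt *m M0)); split; first split.
- by elim/ord3_ind.
- by rewrite det_inv dMMM invr1.
- by rewrite -tinf; apply: mxtrace_inv2; rewrite ?mulmxV.
- by rewrite -!mulmxA !(mulmxA M1) mulVmx.
- by apply/rowP; elim/ord3_ind; rewrite mxE.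
Qed.

(** In the three cyclic orders, [A], [B], [C] of [realize_triple] serve as M_i, M_j, M_k, because
    M_i M_j M_k is a rotation of M_1 M_t M_0. *)
Lemma realize_lines4 i j k (X : 'rV[K]_3) l m : uniq [:: i; j; k] ->
    l != 0 -> m != 0 -> l + l^-1 = a i -> m + m^-1 = a j ->
    X 0 k = prod_val l m -> l * m * X 0 i + X 0 j = m * ainf + l * a k ->
  exists (M : 'I_3 -> 'M[K]_2) (Minf : 'M[K]_2),
    quadruple a ainf M Minf /\ trace_coords M = X.
Proof.
move=> ijk; elim/uniq3_ind: i j k / ijk l m => [i j k IH|||].
all: move=> l m l0 m0 li mj Xk h.
  (* Exchanging i and j swaps the eigenvalues; inverting them as well restores the normal form after
     multiplication by lm. *)
  apply: (IH m^-1 l^-1); rewrite ?invr_eq0 ?invrK //; try by rewrite addrC.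
    by rewrite Xk /prod_val; field; rewrite l0 m0 oner_neq0.
  have lm0 : l * m != 0 by rewrite mulf_neq0.
  apply: (mulfI lm0); transitivity (l * m * X 0 j + X 0 i).
    by field; rewrite l0 m0.
  by rewrite h; field; rewrite l0 m0.
all: have [A [B [C [[dA dB dC] [[tA tB tC tABC] [tBC tCA tAB]]]]]] :=
  realize_triple l0 m0 h.
all: rewrite li in tA; rewrite mj in tB; rewrite -[RHS]Xk in tAB.
- exact: (@realize_quadruple C B A).
- apply: (@realize_quadruple B A C) => //; split=> //.
  by rewrite -mulmxA mxtrace_mulC.
- apply: (@realize_quadruple A C B) => //; split=> //.
  by rewrite mxtrace_mulC mulmxA.
Qed.

(* [realize_triple] supplies M_k, the loop at infinity (conjugated as in
   [Minf_for] when k = t) and one more matrix; the relation then determines the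
   fourth, which is M_t, or M_0 when k = t. *)
Lemma realize_lines4_inf i j k (X : 'rV[K]_3) l m : uniq [:: i; j; k] ->
    l != 0 -> m != 0 -> l + l^-1 = a k -> m + m^-1 = ainf ->
    X 0 k = prod_val l m -> l * m * X 0 i + X 0 j = l * a i + m * a j ->
  exists (M : 'I_3 -> 'M[K]_2) (Minf : 'M[K]_2),
    quadruple a ainf M Minf /\ trace_coords M = X.
Proof.
move=> ijk; elim/uniq3_ind: i j k / ijk l m => [i j k IH|||].
all: move=> l m l0 m0 lk minf Xk h.
  (* The eigenvalues belong to k and infinity, so exchanging i and j only inverts them. *)
  apply: (IH l^-1 m^-1); rewrite ?invr_eq0 ?invrK //; try by rewrite addrC.
    by rewrite Xk /prod_val; field; rewrite l0 m0 oner_neq0.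
  have lm0 : l * m != 0 by rewrite mulf_neq0.
  apply: (mulfI lm0); transitivity (l * m * X 0 j + X 0 i).
    by field; rewrite l0 m0.
  by rewrite h; field; rewrite l0 m0.
(* The cycle is M_0 M_inf M_1 M_t = 1, with factors [A], [B], [C], [D]. *)
- have h' : l * m * X 0 s1 + X 0 st = m * a st + l * a s1 by rewrite h addrC.
  have [A [B [C [[dA dB dC] [[tA tB tC tABC] [tBC tCA tAB]]]]]] :=
    realize_triple l0 m0 h'.
  have [D [dD tD tCDA tCD tDA]] := complete_cycle4 dA dB dC.
  apply: (@realize_quadruple A D C) => //; split.
  - by rewrite tA.
  - by rewrite tD.
  - by [].
  - by rewrite tCDA tB.
  - by rewrite tCD tAB Xk.
  - by rewrite mxtrace_mulC.
  - by rewrite tDA.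
(* The same cycle M_0 M_inf M_1 M_t = 1, now with factors [C], [A], [B], [D]; here M_inf precedes
   M_1, hence the exchange of l and m. *)
- have h' : m * l * X 0 st + X 0 s0 = l * a st + m * a s0 by rewrite (mulrC m).
  have [A [B [C [[dA dB dC] [[tA tB tC tABC] [tBC tCA tAB]]]]]] :=
    realize_triple m0 l0 h'.
  have [D [dD tD tBDC tBD tDC]] := complete_cycle4 dC dA dB.
  apply: (@realize_quadruple C D B) => //; split=> //.
  - by rewrite tD -mulmxA mxtrace_mulC.
  - by rewrite tB.
  - by rewrite tBDC tA.
  - by rewrite tBD.
  - by rewrite mxtrace_mulC.
  - by rewrite tDC tAB Xk /prod_val (mulrC m).
(* With N = M_1^-1 M_inf M_1 the relation reads M_1 N M_t M_0 = 1, with factors [C], [A], [B],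
   [D]. *)
- have h' : m * l * X 0 s0 + X 0 s1 = l * a s0 + m * a s1 by rewrite (mulrC m).
  have [A [B [C [[dA dB dC] [[tA tB tC tABC] [tBC tCA tAB]]]]]] :=
    realize_triple m0 l0 h'.
  have [D [dD tD tBDC tBD tDC]] := complete_cycle4 dC dA dB.
  apply: (@realize_quadruple D B C) => //; split=> //.
  - by rewrite tD -mulmxA mxtrace_mulC.
  - by rewrite tB.
  - by rewrite -mulmxA mxtrace_mulC tBDC tA.
  - by rewrite mxtrace_mulC.
  - by rewrite tDC tAB Xk /prod_val (mulrC m).
  - by rewrite tBD.
Qed.

End Quadruples.

Theorem proposition4p5 (R : realType) (e : 'I_3 -> R[i]) (einf : R[i])
    (he : forall l, e l != 0) (heinf : einf != 0) :
  let a : 'I_3 -> R[i] := fun l => e l + (e l)^-1 in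
  let ainf : R[i] := einf + einf^-1 in
  let F : {mpoly R[i][3]} := fricke (theta a ainf) (theta_inf a ainf) in
  let S : set 'rV[R[i]]_3 := S_VI (theta a ainf) (theta_inf a ainf) in
  [/\ (* the four decompositions *)
      forall i j k : 'I_3, uniq [:: i; j; k] ->
      [/\ F = ('X_k - (e i / e j)%:MP - (e j / e i)%:MP)
              * (F^`M(k) - 'X_k + (e i / e j)%:MP + (e j / e i)%:MP)
            + (e i * e j)^-1 *:
              ((e i *: 'X_i + e j *: 'X_j - ainf%:MP - (e i * e j * a k)%:MP)
             * (e i *: 'X_j + e j *: 'X_i - (a k)%:MP
                - (e i * e j * ainf)%:MP)),
          F = ('X_k - (e i * e j)%:MP - ((e i * e j)^-1)%:MP)
              * (F^`M(k) - 'X_k + (e i * e j)%:MP + ((e i * e j)^-1)%:MP)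
            + (e i * e j)^-1 *:
              (((e i * e j) *: 'X_i + 'X_j - (e j * ainf)%:MP
                - (e i * a k)%:MP)
             * ((e i * e j) *: 'X_j + 'X_i - (e j * a k)%:MP
                - (e i * ainf)%:MP)),
          F = ('X_k - (e k / einf)%:MP - (einf / e k)%:MP)
              * (F^`M(k) - 'X_k + (e k / einf)%:MP + (einf / e k)%:MP)
            + (e k * einf)^-1 *:
              ((einf *: 'X_i + e k *: 'X_j - (a i)%:MP
                - (e k * einf * a j)%:MP)
             * (e k *: 'X_i + einf *: 'X_j - (a j)%:MP
                - (e k * einf * a i)%:MP))
        & F = ('X_k - (e k * einf)%:MP - ((e k * einf)^-1)%:MP)
              * (F^`M(k) - 'X_k + (e k * einf)%:MP + ((e k * einf)^-1)%:MP)
            + (e k * einf)^-1 *: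
              (('X_j + (e k * einf) *: 'X_i - (e k * a i)%:MP
                - (einf * a j)%:MP)
             * ('X_i + (e k * einf) *: 'X_j - (e k * a j)%:MP
                - (einf * a i)%:MP))],
      (* the 24 lines, counted with multiplicity *)
      [/\ size (lines24 e einf) = 24%N,
          forall i j k : 'I_3, uniq [:: i; j; k] ->
            perm_eq (lines24 e einf)
              (lines8 e einf i j k ++ lines8 e einf j k i
               ++ lines8 e einf k i j)
        & forall L : set 'rV[R[i]]_3,
            L \in lines24 e einf -> is_line L /\ L `<=` S],
      (* each plane cuts the surface in two lines *)
      forall i j k : 'I_3, uniq [:: i; j; k] ->
      [/\ plane k (quot_val (e i) (e j)) `&` S
            = (quot_lines e einf i j k).1 `|` (quot_lines e einf i j k).2,
          plane k (prod_val (e i) (e j)) `&` S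
            = (prod_lines e einf i j k).1 `|` (prod_lines e einf i j k).2,
          plane k (quot_val (e k) einf) `&` S
            = (quot_lines_inf e einf i j k).1
              `|` (quot_lines_inf e einf i j k).2
        & plane k (prod_val (e k) einf) `&` S
            = (prod_lines_inf e einf i j k).1
              `|` (prod_lines_inf e einf i j k).2]
    & (* the four lines of a pair correspond to its reducibility *)
      forall i j k : 'I_3, uniq [:: i; j; k] ->
      [/\ forall (M : 'I_3 -> 'M[R[i]]_2) (Minf : 'M[R[i]]_2),
            quadruple a ainf M Minf ->
            reducible_pair (M i) (M j)
              <-> lines4 e einf i j k (trace_coords M),
          forall X, lines4 e einf i j k X ->
            exists (M : 'I_3 -> 'M[R[i]]_2) (Minf : 'M[R[i]]_2),
              quadruple a ainf M Minf /\ trace_coords M = X,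
          forall (M : 'I_3 -> 'M[R[i]]_2) (Minf : 'M[R[i]]_2),
            quadruple a ainf M Minf ->
            reducible_pair (M k) (Minf_for M Minf k)
              <-> lines4_inf e einf i j k (trace_coords M)
        & forall X, lines4_inf e einf i j k X ->
            exists (M : 'I_3 -> 'M[R[i]]_2) (Minf : 'M[R[i]]_2),
              quadruple a ainf M Minf /\ trace_coords M = X]].
Proof.
move=> a ainf F S; split.
- move=> i j k ijk.
  have unitC (c : R[i]) : c != 0 -> c%:MP_[3] * c^-1%:MP = 1.
    by move=> c0; rewrite -mpolyCM mulfV.
  have FE := fricke_poly_form a ainf ijk.
  (* The pair symmetry of F yields the two decompositions attached to {k, infinity}. *)
  have FE' : F = _ := etrans FE (esym (fricke_form_pair _ _ _ _ _ _ _)).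
  rewrite -/F /a /ainf !(mpolyCD _ _ (_^-1)) in FE FE'.
  have DE := fricke_deriv a ainf ijk; rewrite -/F in DE.
  have uE l := unitC _ (he l); have uinfE := unitC _ heinf.
  split.
  + rewrite {1}FE (fricke_form_quot _ _ _ _ _ (uE i) (uE j)) DE /a /ainf.
    by rewrite !invfM -!mul_mpolyC; ring.
  + rewrite {1}FE (fricke_form_prod _ _ _ _ _ (uE i) (uE j)) DE /a /ainf.
    by rewrite !invfM -!mul_mpolyC; ring.
  + rewrite {1}FE' (fricke_form_quot _ _ _ _ _ (uE k) uinfE) DE /a /ainf.
    by rewrite !invfM -!mul_mpolyC; ring.
  + rewrite {1}FE' (fricke_form_prod _ _ _ _ _ (uE k) uinfE) DE /a /ainf.
    by rewrite !invfM -!mul_mpolyC; ring.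
- split=> //; first exact: lines24_perm.
  by move=> L; apply: lines24_spec.
- move=> i j k ijk; split.
  + exact: plane_quot.
  + exact: plane_prod.
  + exact: plane_quot_inf.
  + exact: plane_prod_inf.
move=> i j k ijk; split.
- move=> M Minf quadM; have [dM _ _ _] := quadM.
  have [[di ti] [dj tj]] := (dM i, dM j).
  (* Both sides become the condition that tr (M_i M_j) takes one of two values. *)
  rewrite (lines4P he ijk (quadruple_S_VI quadM)) (trace_coordsE M ijk).
  exact: reducible_pairP.
- move=> X /(lines4_eigenvalues he heinf)[l [m [l0 m0 li mj [Xk h]]]].
  exact: realize_lines4 ijk l0 m0 li mj Xk h.
- move=> M Minf quadM; have [dk tk] : \det (M k) = 1 /\ \tr (M k) = a k.
    by case: quadM.
  have [dinf tinf tX] := Minf_for_spec k quadM.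
  rewrite (lines4_infP he heinf ijk (quadruple_S_VI quadM)) -tX.
  exact: reducible_pairP.
- move=> X /(lines4_inf_eigenvalues he heinf)[l [m [l0 m0 lk minf [Xk h]]]].
  exact: realize_lines4_inf ijk l0 m0 lk minf Xk h.
Qed.
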